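(* Consider the first-order STORM algorithm applied to expected risk minimization in the setting of the context, with $p=1-\delta_0-\delta_1>\frac12$ and $q=1-p>0$. Let $C_1$ be sufficiently large that $\frac{C_1}{\varepsilon^2}\ge\mathbb E[T_\varepsilon]$, let $C_2>1$ be arbitrary, and let the integer $n\ge2$ be such that $n\ge C_2\frac{C_1}{\varepsilon^2}$. Let $\omega>0$ be arbitrary and let $\gamma\in(0,1)$ satisfy $\gamma\ge\max\left\{\frac12,\left(\frac1{2q}\right)^{\frac{\log(2\beta)}{(1+\omega)\log n}}\right\}$ for some $0<\beta\le\frac12$. Then, with probability at least $1-\frac1{C_2}-\mathcal O(n^{-\omega})$, $$\mathsf{TOC}(T_\varepsilon)\le\mathcal O\left(\frac{\sigma_f^2}{\varepsilon^6}+\frac{\sigma_g^2}{\varepsilon^4}\right).$$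
   Context: Problem: minimize $\phi(x)=\mathbb E_{d\sim\mathcal D}[\ell(x,d)]$ over $x\in\mathbb R^m$, with $\phi$ being $L$-smooth and bounded below (possibly non-convex). Assumptions: $\mathrm{Var}_{d}[\ell(x,d)]\le\sigma_f^2$, $\mathbb E_d[\nabla_x\ell(x,d)]=\nabla\phi(x)$ and $\mathbb E_d\|\nabla_x\ell(x,d)-\nabla\phi(x)\|^2\le\sigma_g^2$ for all $x$. First-order STORM (stochastic trust-region). Parameters $\gamma\in(0,1)$, $\theta\in(0,1)$, $\theta_2>0$, $\alpha_{\max}$, $x_0$, $\alpha_0\le\alpha_{\max}$. At iteration $k$, with trust-region radius $\alpha_k$: obtain gradient estimate $g_k$, form $m_k(x_k+s)=\phi(x_k)+g_k^Ts+\frac12s^TH_ks$, let $s_k$ minimize $m_k(x_k+s)$ over $\|s\|\le\alpha_k$, and obtain function estimates $f_k^0\approx\phi(x_k)$, $f_k^+\approx\phi(x_k+s_k)$. The step is successful if $\frac{f_k^0-f_k^+}{m_k(x_k)-m_k(x_k+s_k)}\ge\theta$ and $\|g_k\|\ge\theta_2\alpha_k$; then $x_{k+1}=x_k+s_k$, $\alpha_{k+1}=\min\{\gamma^{-1}\alpha_k,\alpha_{\max}\}$. Otherwise $x_{k+1}=x_k$, $\alpha_{k+1}=\gamma\alpha_k$. Let $\mathcal A_k$ be the random variable with realization $\alpha_k$ and $\mathcal F_k$ the filtration generated up to iteration $k$. $T_\varepsilon=\min\{k:\|\nabla\phi(x_k)\|\le\varepsilon\}$. Oracles, given $x$ and $\alpha$,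 by minibatch averaging of i.i.d. samples of $\ell(x,d)$, $\nabla_x\ell(x,d)$: the function estimate satisfies $\mathbb P(|f-\phi(x)|\le\kappa_{ef}\alpha^2)\ge1-\delta_0$, the gradient estimate satisfies $\mathbb P(\|g-\nabla\phi(x)\|\le\kappa_{eg}\alpha)\ge1-\delta_1$. By Chebyshev's inequality the sample costs per call are taken to be $\mathsf{oc}_0(\alpha)=\frac{\sigma_f^2}{\delta_0\kappa_{ef}^2\alpha^4}$ and $\mathsf{oc}_1(\alpha)=\frac{\sigma_g^2}{\delta_1\kappa_{eg}^2\alpha^2}$. Total sample complexity: $\mathsf{TOC}(T_\varepsilon)=\sum_{k=1}^{T_\varepsilon}\big(\mathsf{oc}_0(\mathcal A_k)+\mathsf{oc}_1(\mathcal A_k)\big)$. Known property of STORM, taken as part of the setting (under appropriate conditions on the algorithmic constants): with $\bar\alpha=\varepsilon/\zeta$, where $\zeta>0$ is a constant depending on $\kappa_{eg}$, $L$ and algorithmic constants, one has for all $k$: $\mathbb P(\mathcal A_{k+1}=\gamma^{-1}\mathcal A_k\mid\mathcal F_k)\ge p$ almost surely on $\{k<T_\varepsilon,\ \mathcal A_k\le\bar\alpha\}$. Standing convention: $\alpha_0\ge\bar\alpha$. $\mathcal O(\cdot)$ hides multiplicative constants independent of $n,\varepsilon,\sigma_f,\sigma_g,\gamma$; they may depend on $\delta_0,\delta_1,\kappa_{ef},\kappa_{eg},\zeta,\beta,C_1,C_2$. *)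

(* Defs.v *)
From HB Require Import structures.
From mathcomp Require Import all_boot all_order all_algebra.
From mathcomp Require Import all_classical all_reals all_analysis.

Set Implicit Arguments.
Unset Strict Implicit.
Unset Printing Implicit Defensive.
Import Order.TTheory GRing.Theory Num.Theory.
Import numFieldNormedType.Exports.
Local Open Scope classical_set_scope.
Local Open Scope ring_scope.

(* The library norm on ['rV[R]_m] is the sup norm; it induces the same topology
   (hence the same [open] and [differentiable]) as the Euclidean norm used here. *)
Definition enorm (R : realType) (m : nat) (v : 'rV[R]_m) : R :=
  Num.sqrt (\sum_(i < m) v 0 i ^+ 2).

Definition grad (R : realType) (m : nat) (f : 'rV[R]_m -> R) (x : 'rV[R]_m) :
  'rV[R]_m := \row_(i < m) 'D_(delta_mx 0 i) f x.

Definition smooth (R : realType) (m : nat) (L : R) (f : 'rV[R]_m -> R) : Prop :=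
  (forall x, differentiable f x) /\
  (forall x y, enorm (grad f x - grad f y) <= L * enorm (x - y)).

Definition risk (R : realType) (dX : measure_display) (Xi : measurableType dX)
    (D : probability Xi R) (m : nat) (l : 'rV[R]_m -> Xi -> R) (x : 'rV[R]_m) : R :=
  fine 'E_D[l x].

Record erm_setting (R : realType) (dX : measure_display) (Xi : measurableType dX)
    (D : probability Xi R) (m : nat) (l : 'rV[R]_m -> Xi -> R)
    (L sigf sigg : R) : Prop := ErmSetting {
  erm_integrable : forall x, D.-integrable setT (EFin \o l x) ;
  erm_smooth : smooth L (risk D l) ;
  erm_bounded_below : exists lb : R, forall x, lb <= risk D l x ;
  erm_variance : forall x, ('V_D[l x] <= (sigf ^+ 2)%:E)%E ;
  erm_differentiable : forall x d, differentiable (l ^~ d) x ;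
  erm_grad_integrable : forall x i,
    D.-integrable setT (EFin \o (fun d => grad (l ^~ d) x 0 i)) ;
  erm_grad_unbiased : forall x i,
    'E_D[fun d => grad (l ^~ d) x 0%R i]%E = (grad (risk D l) x 0 i)%:E ;
  erm_grad_variance : forall x,
    ('E_D[fun d => (enorm (grad (l ^~ d) x - grad (risk D l) x) ^+ 2)%R]
       <= (sigg ^+ 2)%:E)%E }.

(* [Z] is a version of the conditional probability P(E | F), for a sub-sigma-algebra
   [F] given as the set of its events. *)
Definition is_cond_prob (R : realType) (dO : measure_display)
    (Omega : measurableType dO) (P : probability Omega R)
    (F : set_system Omega) (E : set Omega) (Z : Omega -> R) : Prop :=
  [/\ forall U : set R, measurable U -> F (Z @^-1` U),
      P.-integrable setT (EFin \o Z) &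
      forall B, F B -> (\int[P]_(w in B) (Z w)%:E = P (E `&` B))%E ].

(* P(E | F) >= p almost surely on B. Versions are almost surely unique, so that
   asking for one of them is the same as asking for all of them. *)
Definition cond_prob_ge (R : realType) (dO : measure_display)
    (Omega : measurableType dO) (P : probability Omega R)
    (F : set_system Omega) (E B : set Omega) (p : R) : Prop :=
  exists Z : Omega -> R, is_cond_prob P F E Z /\
    {ae P, forall w, B w -> p <= Z w}.

(* [Y] is a sequence of i.i.d. random elements of law [D], independent of [F]. *)
Definition iid_indep_of (R : realType) (dO dX : measure_display)
    (Omega : measurableType dO) (P : probability Omega R)
    (Xi : measurableType dX) (D : probability Xi R)
    (F : set_system Omega) (Y : nat -> Omega -> Xi) : Prop :=
  (forall i, measurable_fun setT (Y i)) /\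
  (forall (B : set Omega) (N : nat) (U : nat -> set Xi),
     F B -> (forall i, measurable (U i)) ->
     (P (B `&` \bigcap_(i in `I_N) (Y i @^-1` U i)) =
      P B * \prod_(i < N) D (U i))%E).

Definition borel_fun (dO : measure_display) (Omega : measurableType dO)
    (T : topologicalType) (f : Omega -> T) : Prop :=
  forall U : set T, open U -> measurable (f @^-1` U).

(* At iteration k: iterate x_k, radius alpha_k, gradient estimate g_k, model Hessian
   H_k, step s_k, function estimates f_k^0 and f_k^+, and the streams of data points
   from which the minibatches for g_k, f_k^0 and f_k^+ are taken. The last two
   streams may be dependent (or even equal). *)
Record storm_run (R : realType) (dO dX : measure_display)
    (Omega : measurableType dO) (Xi : measurableType dX) (m : nat) := StormRun {
  rx : nat -> Omega -> 'rV[R]_m ;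
  ralpha : nat -> Omega -> R ;
  rg : nat -> Omega -> 'rV[R]_m ;
  rH : nat -> Omega -> 'M[R]_m ;
  rs : nat -> Omega -> 'rV[R]_m ;
  rf0 : nat -> Omega -> R ;
  rfp : nat -> Omega -> R ;
  data_g : nat -> nat -> Omega -> Xi ;
  data_f0 : nat -> nat -> Omega -> Xi ;
  data_fp : nat -> nat -> Omega -> Xi }.

Definition open_events (Omega : Type) (T : topologicalType) (f : Omega -> T) :
  set_system Omega := preimage_set_system setT f open.

Definition data_events (Omega : Type) (dX : measure_display)
    (Xi : measurableType dX) (Y : nat -> Omega -> Xi) : set_system Omega :=
  \bigcup_i preimage_set_system setT (Y i) measurable.

Definition state_events (R : realType) (dO dX : measure_display)
    (Omega : measurableType dO) (Xi : measurableType dX) (m : nat)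
    (St : storm_run R Omega Xi m) (k : nat) : set_system Omega :=
  open_events (rx St k) `|` open_events (ralpha St k).

Definition model_events (R : realType) (dO dX : measure_display)
    (Omega : measurableType dO) (Xi : measurableType dX) (m : nat)
    (St : storm_run R Omega Xi m) (k : nat) : set_system Omega :=
  data_events (data_g St k) `|` open_events (rg St k) `|` open_events (rH St k)
    `|` open_events (rs St k).

Definition value_events (R : realType) (dO dX : measure_display)
    (Omega : measurableType dO) (Xi : measurableType dX) (m : nat)
    (St : storm_run R Omega Xi m) (k : nat) : set_system Omega :=
  data_events (data_f0 St k) `|` data_events (data_fp St k)
    `|` open_events (rf0 St k) `|` open_events (rfp St k).

Definition past_events (R : realType) (dO dX : measure_display)
    (Omega : measurableType dO) (Xi : measurableType dX) (m : nat)
    (St : storm_run R Omega Xi m) (k : nat) : set_system Omega :=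
  (\bigcup_(j in [set j | (j <= k)%N]) state_events St j) `|`
  (\bigcup_(j in [set j | (j < k)%N]) (model_events St j `|` value_events St j)).

(* F_k: everything known when iteration k starts, i.e. x_0, alpha_0, ..., x_k,
   alpha_k and the randomness of the iterations 0, ..., k-1. *)
Definition filtration (R : realType) (dO dX : measure_display)
    (Omega : measurableType dO) (Xi : measurableType dX) (m : nat)
    (St : storm_run R Omega Xi m) (k : nat) : set_system Omega :=
  <<s past_events St k >>.

(* F_k enlarged by g_k, H_k, s_k: what is known when the function values at x_k and
   x_k + s_k are estimated. *)
Definition filtration_mid (R : realType) (dO dX : measure_display)
    (Omega : measurableType dO) (Xi : measurableType dX) (m : nat)
    (St : storm_run R Omega Xi m) (k : nat) : set_system Omega :=
  <<s past_events St k `|` model_events St k >>.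

(* s |-> m_k(x_k + s), with c = phi(x_k). *)
Definition qmodel (R : realType) (m : nat) (c : R) (g : 'rV[R]_m) (H : 'M[R]_m)
    (s : 'rV[R]_m) : R :=
  c + (g *m s^T) 0 0 + 2^-1 * (s *m H *m s^T) 0 0.

Definition storm_model (R : realType) (dO dX : measure_display)
    (Omega : measurableType dO) (Xi : measurableType dX) (m : nat)
    (phi : 'rV[R]_m -> R) (St : storm_run R Omega Xi m) (k : nat) (w : Omega) :
    'rV[R]_m -> R :=
  qmodel (phi (rx St k w)) (rg St k w) (rH St k w).

(* If m_k(x_k) = m_k(x_k + s_k), the quotient is 0 and the step is not successful. *)
Definition storm_success (R : realType) (dO dX : measure_display)
    (Omega : measurableType dO) (Xi : measurableType dX) (m : nat)
    (phi : 'rV[R]_m -> R) (theta theta2 : R)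
    (St : storm_run R Omega Xi m) (k : nat) (w : Omega) : bool :=
  (theta <= (rf0 St k w - rfp St k w) /
            (storm_model phi St k w 0 - storm_model phi St k w (rs St k w)))
  && (theta2 * ralpha St k w <= enorm (rg St k w)).

Record storm_algorithm (R : realType) (dO dX : measure_display)
    (Omega : measurableType dO) (Xi : measurableType dX) (m : nat)
    (phi : 'rV[R]_m -> R) (gamma theta theta2 alphamax alpha0 : R)
    (x0 : 'rV[R]_m) (St : storm_run R Omega Xi m) : Prop := StormAlgorithm {
  storm_borel : forall k,
    borel_fun (rx St k) /\ borel_fun (ralpha St k) /\ borel_fun (rg St k) /\
    borel_fun (rH St k) /\ borel_fun (rs St k) /\
    borel_fun (rf0 St k) /\ borel_fun (rfp St k) ;
  storm_init : forall w, rx St 0 w = x0 /\ ralpha St 0 w = alpha0 ;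
  storm_step : forall k w, enorm (rs St k w) <= ralpha St k w /\
    forall s, enorm s <= ralpha St k w ->
      storm_model phi St k w (rs St k w) <= storm_model phi St k w s ;
  storm_next_x : forall k w, rx St k.+1 w =
    if storm_success phi theta theta2 St k w then rx St k w + rs St k w
    else rx St k w ;
  storm_next_alpha : forall k w, ralpha St k.+1 w =
    if storm_success phi theta theta2 St k w
    then Num.min (gamma^-1 * ralpha St k w) alphamax
    else gamma * ralpha St k w }.

Definition oc0 (R : realType) (sigf delta0 kef alpha : R) : R :=
  sigf ^+ 2 / (delta0 * kef ^+ 2 * alpha ^+ 4).

Definition oc1 (R : realType) (sigg delta1 keg alpha : R) : R :=
  sigg ^+ 2 / (delta1 * keg ^+ 2 * alpha ^+ 2).

(* The integer number of samples drawn for the cost c: c rounded up, at least 1. *)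
Definition batch (R : realType) (c : R) : nat := maxn 1 `|Num.ceil c|%N.

Record storm_oracles (R : realType) (dO dX : measure_display)
    (Omega : measurableType dO) (P : probability Omega R)
    (Xi : measurableType dX) (D : probability Xi R) (m : nat)
    (l : 'rV[R]_m -> Xi -> R) (sigf sigg delta0 delta1 kef keg : R)
    (St : storm_run R Omega Xi m) : Prop := StormOracles {
  iid_g : forall k, iid_indep_of P D (filtration St k) (data_g St k) ;
  iid_f0 : forall k, iid_indep_of P D (filtration_mid St k) (data_f0 St k) ;
  iid_fp : forall k, iid_indep_of P D (filtration_mid St k) (data_fp St k) ;
  minibatch_g : forall k w,
    let N := batch (oc1 sigg delta1 keg (ralpha St k w)) in
    rg St k w = N%:R^-1 *: \sum_(i < N) grad (l ^~ (data_g St k i w)) (rx St k w) ;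
  minibatch_f0 : forall k w,
    let N := batch (oc0 sigf delta0 kef (ralpha St k w)) in
    rf0 St k w = N%:R^-1 * \sum_(i < N) l (rx St k w) (data_f0 St k i w) ;
  minibatch_fp : forall k w,
    let N := batch (oc0 sigf delta0 kef (ralpha St k w)) in
    rfp St k w =
      N%:R^-1 * \sum_(i < N) l (rx St k w + rs St k w) (data_fp St k i w) ;
  accuracy_g : forall k, cond_prob_ge P (filtration St k)
    [set w | enorm (rg St k w - grad (risk D l) (rx St k w))
               <= keg * ralpha St k w] setT (1 - delta1) ;
  accuracy_f0 : forall k, cond_prob_ge P (filtration_mid St k)
    [set w | `|rf0 St k w - risk D l (rx St k w)| <= kef * ralpha St k w ^+ 2]
    setT (1 - delta0) ;
  accuracy_fp : forall k, cond_prob_ge P (filtration_mid St k)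
    [set w | `|rfp St k w - risk D l (rx St k w + rs St k w)|
               <= kef * ralpha St k w ^+ 2] setT (1 - delta0) }.

(* T_eps, with value +oo where the gradient norm never reaches eps. *)
Definition stop_time (R : realType) (dO dX : measure_display)
    (Omega : measurableType dO) (Xi : measurableType dX) (m : nat)
    (phi : 'rV[R]_m -> R) (eps : R) (St : storm_run R Omega Xi m)
    (w : Omega) : \bar R :=
  ereal_inf [set (k%:R)%:E | k in
    [set k : nat | enorm (grad phi (rx St k w)) <= eps]].

Definition TOC (R : realType) (dO dX : measure_display)
    (Omega : measurableType dO) (Xi : measurableType dX) (m : nat)
    (phi : 'rV[R]_m -> R) (eps sigf sigg delta0 delta1 kef keg : R)
    (St : storm_run R Omega Xi m) (w : Omega) : \bar R :=
  (\sum_(1 <= k <oo | ((k%:R)%:E <= stop_time phi eps St w)%E)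
     (oc0 sigf delta0 kef (ralpha St k w) +
      oc1 sigg delta1 keg (ralpha St k w))%:E)%E.

(* P(A_{k+1} = A_k / gamma | F_k) >= p a.s. on {k < T_eps, A_k <= eps / zeta}. *)
Definition storm_increase_property (R : realType) (dO dX : measure_display)
    (Omega : measurableType dO) (P : probability Omega R)
    (Xi : measurableType dX) (m : nat) (phi : 'rV[R]_m -> R)
    (eps zeta gamma p : R) (St : storm_run R Omega Xi m) : Prop :=
  forall k, cond_prob_ge P (filtration St k)
    [set w | ralpha St k.+1 w = gamma^-1 * ralpha St k w]
    [set w | ((k%:R)%:E < stop_time phi eps St w)%E /\
             ralpha St k w <= eps / zeta] p.

(* Main.v *)
Require Import Defs.
From HB Require Import structures.
From mathcomp Require Import all_boot all_order all_algebra.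
From mathcomp Require Import all_classical all_reals all_analysis.
From mathcomp Require Import measurable_realfun lra ring.
Import Order.TTheory GRing.Theory Num.Theory.
Import numFieldNormedType.Exports.
Local Open Scope classical_set_scope.
Local Open Scope ring_scope.
Set Implicit Arguments.
Unset Strict Implicit.
Unset Printing Implicit Defensive.

(** With [r = q / p] and [gamma ^ lam = r], the potential [V s = (a / s) ^ lam] is a
    supermartingale along the trust-region radius while the radius is at most
    [abar = eps / zeta] and the gradient norm exceeds [eps]. An excursion above [abar]
    re-enters at a radius of at least [gamma * abar], hence within [n] steps the radius
    sinks to [a = 2 beta abar] with probability at most
    [V abar + n V (gamma abar) <= n V abar / q = n (2 beta) ^ lam / q]. The lower bound
    on [gamma] says precisely that [(2 beta) ^ lam <= n ^ - (1 + omega)], using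
    [q / p <= 2 q]. By Markov's inequality [T_eps < C2 C1 / eps^2 <= n] fails with
    probability at most [1 / C2]; otherwise at most [C2 C1 / eps^2] iterations are paid
    for, each at a radius of at least [a]. *)

(** * Probabilities as real numbers *)

Definition pr (R : realType) (d : measure_display) (T : measurableType d)
  (P : probability T R) (A : set T) : R := fine (P A).

Section pr_theory.
Context (R : realType) (d : measure_display) (T : measurableType d).
Context (P : probability T R).
Implicit Types A B : set T.

Lemma prE A : measurable A -> (pr P A)%:E = P A.
Proof.
by move=> mA; rewrite /pr fineK// ge0_fin_numE// (le_lt_trans (probability_le1 P mA)) ?ltry.
Qed.

Lemma pr_ge0 A : 0 <= pr P A.
Proof. exact: fine_ge0. Qed.

Lemma pr_le A B : measurable A -> measurable B -> A `<=` B ->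
  pr P A <= pr P B.
Proof.
by move=> mA mB AB; rewrite -lee_fin !prE//; apply: le_measure => //; rewrite inE.
Qed.

Lemma pr_split A B : measurable A -> measurable B ->
  pr P A = pr P (A `&` B) + pr P (A `&` ~` B).
Proof.
move=> mA mB; apply: EFin_inj.
have mAB : measurable (A `&` B) by exact: measurableI.
have mAC : measurable (A `&` ~` B) by apply: measurableI => //; exact: measurableC.
by rewrite EFinD !prE// (measureDI P mA mB) setDE addeC.
Qed.

(** Integrating a version of the conditional probability over the past event [B] yields the
    right-hand side; integrating its lower bound yields the left-hand side. *)
Lemma cond_prob_ge_le (F : set_system T) (E B C : set T) (p : R) :
  0 <= p -> F `<=` measurable -> measurable E ->
  cond_prob_ge P F E C p -> F B -> B `<=` C ->
  p * pr P B <= pr P (E `&` B).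
Proof.
move=> p0 Fm mE [Z [[_ iZ ZE] aeZ]] FB BC.
have mB : measurable B by exact: Fm.
have mZ : measurable_fun setT Z.
  by have /measurable_int/measurable_EFinP := iZ.
rewrite -lee_fin EFinM !prE//; last exact: measurableI.
rewrite -ZE// -(integral_cst P mB p%:E).
(* [p <= Z] holds only almost surely on [C], so [Z] is replaced by its maximum with [p], which has
   the same integral over [B] and is bounded below everywhere. *)
have mM : measurable_fun setT (Z \max cst p) by exact: measurable_maxr.
rewrite (ae_eq_integral (fun w => ((Z \max cst p) w)%:E) (fun w => (Z w)%:E))//.
- apply: ge0_le_integral => //=.
  + by apply/measurable_EFinP; exact: measurable_funTS.
  + by move=> x _; rewrite lee_fin le_max lexx orbT.
- by apply/measurable_EFinP; exact: measurable_funTS.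
- by apply/measurable_EFinP; exact: measurable_funTS.
- apply: filterS aeZ => w h Bw /=.
  by rewrite max_l// h//; exact: BC.
Qed.

End pr_theory.

(** * Random walks that drift upwards at low levels *)

(** Separates the radius argument from the algorithm: models, samples and acceptance tests are gone,
    and the closure of [F k] is stated for finite Boolean operations. *)
Record drifting_walk (R : realType) (d : measure_display) (T : measurableType d)
    (P : probability T R) (F : nat -> set_system T) (A : nat -> T -> R)
    (alive : nat -> set T) (gamma p abar : R) : Prop := DriftingWalk {
  walk_setI : forall k B C, F k B -> F k C -> F k (B `&` C) ;
  walk_setC : forall k B, F k B -> F k (~` B) ;
  walk_mono : forall k, F k `<=` F k.+1 ;
  walk_measurable : forall k, F k `<=` measurable ;
  walk_level : forall k c, F k [set w | A k w <= c] /\ F k [set w | c <= A k w] ;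
  walk_alive : forall k, F k (alive k) ;
  walk_jump_measurable : forall k,
    measurable [set w | A k.+1 w = gamma^-1 * A k w] ;
  walk_down : forall k w, gamma * A k w <= A k.+1 w ;
  walk_up : forall k, cond_prob_ge P (F k)
    [set w | A k.+1 w = gamma^-1 * A k w]
    [set w | alive k w /\ A k w <= abar] p }.

(* Some [A i] with [k <= i <= k + j] is at most [a], and the walk is alive at the
   times [k, ..., i - 1]. *)
Fixpoint low_hit (R : realType) (T : Type) (A : nat -> T -> R)
    (alive : nat -> set T) (a : R) (k j : nat) : set T :=
  if j is j'.+1
  then [set w | A k w <= a] `|` (alive k `&` low_hit A alive a k.+1 j')
  else [set w | A k w <= a].

(** Used in contrapositive: outside the hit event, every radius reached alive within the horizon
    exceeds [a]. *)
Lemma low_hit_at (R : realType) (T : Type) (A : nat -> T -> R)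
    (alive : nat -> set T) (a : R) (w : T) (j k i : nat) :
  (i <= j)%N -> (forall l, (l < i)%N -> alive (k + l)%N w) ->
  A (k + i)%N w <= a -> low_hit A alive a k j w.
Proof.
elim: j k i => [|j IHj] k [|i]//= ij al Ai; rewrite ?addn0 in Ai => //.
  by left.
right; split; first by have := al 0%N isT; rewrite addn0.
apply: (IHj _ i) => //.
  by move=> l li; rewrite addSnnS; exact: al.
by rewrite addSnnS.
Qed.

Section drifting_walk_theory.
Context (R : realType) (d : measure_display) (T : measurableType d).
Context (P : probability T R) (F : nat -> set_system T) (A : nat -> T -> R).
Context (alive : nat -> set T) (gamma p abar a : R).
Context (WF : drifting_walk P F A alive gamma p abar).

Lemma low_hit_measurable k j : measurable (low_hit A alive a k j).
Proof.
have [_ _ _ Fm Flev Fal _ _ _] := WF.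
have mA i : measurable [set w | A i w <= a] by have [/Fm] := Flev i a.
elim: j k => [|j IHj] k //=.
apply: measurableU => //; apply: measurableI => //.
exact: Fm (Fal k).
Qed.

(* The potential [V] bounds the probability of ever sinking to the level [a] from
   below [abar]; each excursion above [abar] re-enters at height at least
   [gamma * abar], which costs at most [V (gamma * abar)] per step. *)
Lemma low_hit_bound (V : R -> R) :
  0 < gamma < 1 -> 0 < p <= 1 -> 0 < abar ->
  (forall s : R, 0 <= V s) -> (forall s t : R, 0 < s <= t -> V t <= V s) ->
  (forall s : R, 0 < s <= a -> 1 <= V s) ->
  (forall s : R, 0 < s -> p * V (gamma^-1 * s) + (1 - p) * V (gamma * s) <= V s) ->
  forall j k s B, F k B -> 0 < s -> (forall w, B w -> s <= A k w) ->
  pr P (B `&` low_hit A alive a k j)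
    <= (V s + j%:R * V (gamma * abar)) * pr P B.
Proof.
move=> /andP[g0 g1] /andP[p0 p1] abar0 V0 Vmono V1 Vdrift.
have [FI FC Fmono Fm Flev Fal mjump down up] := WF.
set kap := V (gamma * abar).
have kap0 : 0 <= kap by exact: V0.
(* For [s <= a] the potential is at least 1, so the bound is no less than the whole mass of [B]. *)
have triv j k s B : F k B -> 0 < s -> s <= a ->
    pr P (B `&` low_hit A alive a k j) <= (V s + j%:R * kap) * pr P B.
  move=> FB s0 sa; have mB := Fm _ _ FB.
  have mI : measurable (B `&` low_hit A alive a k j).
    by apply: measurableI => //; exact: low_hit_measurable.
  apply: (@le_trans _ _ (pr P B)); first by apply: pr_le => //; exact: subIsetl.
  rewrite ler_peMl ?pr_ge0// -[1]addr0 lerD ?mulr_ge0//.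
  by rewrite V1// s0.
elim=> [|j IHj] k s B FB s0 sA; have [sa|as_] := leP s a; try exact: triv.
  rewrite [_ `&` _](_ : _ = set0); last first.
    apply/seteqP; split => // w [/sA sw /= wa].
    by have := lt_le_trans as_ (le_trans sw wa); rewrite ltxx.
  by rewrite /pr measure0/= mulr_ge0 ?fine_ge0// addr_ge0// mulr_ge0.
have mB := Fm _ _ FB.
set B' := B `&` alive k.
have FB' : F k B' by exact: FI.
set N := [set w | A k w <= abar].
have FN : F k N by have [] := Flev k abar.
set H := low_hit A alive a k.+1 j.
have mH : measurable H by exact: low_hit_measurable.
(* As [s] exceeds [a], a hit at time [k] is impossible on [B]: the walk must be alive and hit
   later. *)
have BH : B `&` low_hit A alive a k j.+1 `<=` B' `&` H.
  move=> w [Bw /= [wa|[alw Hw]]]; last by [].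
  by have := lt_le_trans as_ (le_trans (sA _ Bw) wa); rewrite ltxx.
have mB' : measurable B' by exact: Fm FB'.
have mN : measurable N by exact: Fm FN.
have mBH : measurable (B `&` low_hit A alive a k j.+1).
  by apply: measurableI => //; exact: low_hit_measurable.
apply: le_trans (pr_le P mBH (measurableI _ _ mB' mH) BH) _.
set D := V s + _.
have D0 : 0 <= D by rewrite addr_ge0// mulr_ge0.
apply: (@le_trans _ _ (D * pr P B')); last first.
  by rewrite ler_wpM2l// pr_le//; exact: subIsetl.
rewrite (pr_split P mB' mN) mulrDr.
rewrite (pr_split P (measurableI _ _ mB' mH) mN) !(setIAC _ H).
set B1 := B' `&` N; set B2 := B' `&` ~` N.
have FB1 : F k B1 by exact: FI.
have FB2 : F k B2 by apply: FI => //; exact: FC.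
have Djk : j%:R * kap + kap = j.+1%:R * kap by rewrite -natr1 mulrDl mul1r.
(* Above [abar] the next radius is at least [gamma * abar], so the induction hypothesis gives
   [j + 1] copies of [kap]; this is what the extra copy per step pays for. *)
apply: lerD; last first.
  have /= := IHj k.+1 (gamma * abar) B2 (Fmono _ _ FB2) (mulr_gt0 g0 abar0).
  move=> /(_ _)/le_trans; apply.
    move=> w [_ /negP]; rewrite -ltNge => /ltW aw.
    by apply: le_trans (down k w); rewrite ler_pM2l.
  by rewrite ler_wpM2r ?pr_ge0// -/kap addrC Djk lerDr V0.
have mB1 : measurable B1 by exact: Fm FB1.
(* The jump event is known to be measurable, but the induction hypothesis needs events of [F k.+1];
   the level set [N1] lies there and contains the jump on [B1]. *)
set N1 := [set w | gamma^-1 * s <= A k.+1 w].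
have FN1 : F k.+1 N1 by have [] := Flev k.+1 (gamma^-1 * s).
have mN1 : measurable N1 by exact: Fm FN1.
have FC1 : F k.+1 (B1 `&` N1) by apply: FI => //; exact: Fmono.
have FC2 : F k.+1 (B1 `&` ~` N1) by apply: FI; [exact: Fmono|exact: FC].
have H1 : pr P ((B1 `&` N1) `&` H) <= (V (gamma^-1 * s) + j%:R * kap) * pr P (B1 `&` N1).
  by apply: IHj => //; [rewrite mulr_gt0 ?invr_gt0|move=> w []].
have H2 : pr P ((B1 `&` ~` N1) `&` H) <= (V (gamma * s) + j%:R * kap) * pr P (B1 `&` ~` N1).
  apply: IHj => //; first by rewrite mulr_gt0.
  move=> w [[[Bw _] _] _]; apply: le_trans (down k w).
  by rewrite ler_pM2l// sA.
have pC1 : p * pr P B1 <= pr P (B1 `&` N1).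
  apply: (@le_trans _ _ (pr P ([set w | A k.+1 w = gamma^-1 * A k w] `&` B1))).
    apply: (cond_prob_ge_le _ _ _ (up k)) => //.
      exact: ltW.
    by move=> w [[_ ?] ?].
  apply: pr_le.
  - exact: measurableI.
  - exact: measurableI.
  - move=> w [/= Aw B1w]; split => //; rewrite /N1/= Aw.
    by rewrite ler_pM2l ?invr_gt0// sA//; case: B1w => -[].
rewrite (pr_split P (measurableI _ _ mB1 mH) mN1) !(setIAC _ H).
rewrite (pr_split P mB1 mN1).
move: (pr_split P mB1 mN1) pC1 H1 H2 => ->.
set x := pr P (B1 `&` N1); set y := pr P (B1 `&` ~` N1).
have x0 : 0 <= x by exact: pr_ge0.
have y0 : 0 <= y by exact: pr_ge0.
move=> pC1 H1 H2.
apply: le_trans (lerD H1 H2) _.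
have := Vdrift _ s0.
have : V (gamma^-1 * s) <= V (gamma * s).
  apply: Vmono; rewrite mulr_gt0//= ler_pM2r// (le_trans (ltW g1))//.
  by rewrite invf_ge1// ltW.
rewrite /D -Djk; move: (V (gamma^-1 * s)) (V (gamma * s)) (V s) H1 H2 => u v z H1 H2 uv dr.
(* The potential is smaller after a rise than after a fall, so mass of [N1] beyond the share [p]
   only lowers the sum. *)
have h1 : (v - u) * (p * (x + y)) <= (v - u) * x by rewrite ler_wpM2l ?subr_ge0.
have h2 : (p * u + (1 - p) * v) * (x + y) <= z * (x + y) by rewrite ler_wpM2r ?addr_ge0.
have h3 : 0 <= kap * (x + y) by rewrite mulr_ge0 ?addr_ge0.
lra.
Qed.

End drifting_walk_theory.

(** * The potential and the condition on [gamma] *)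

(** The exponent makes the two step factors inverse to each other, so that the mean of [V] under a
    coin of bias [p] is unchanged. It is nonnegative because [p > 1/2] and [gamma < 1], hence [V] is
    nonincreasing. *)
Lemma drift_potential (R : realType) (gamma p a : R) :
  0 < gamma < 1 -> 2^-1 < p < 1 -> 0 < a ->
  let V (s : R) : R := (a / s) `^ (ln ((1 - p) / p) / ln gamma) in
  [/\ forall s t : R, 0 < s <= t -> V t <= V s,
      forall s : R, 0 < s <= a -> 1 <= V s &
      forall s : R, 0 < s ->
        V (gamma^-1 * s) = (1 - p) / p * V s /\
        V (gamma * s) = p / (1 - p) * V s].
Proof.
move=> /andP[g0 g1] /andP[p2 p1] a0; set lam := _ / _ => V.
have p0 : 0 < p by lra.
have q0 : 0 < 1 - p by lra.
have r0 : 0 < (1 - p) / p by exact: divr_gt0.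
have lng : ln gamma < 0 by rewrite ln_lt0// g0.
have lam0 : 0 <= lam.
  rewrite /lam -mulrNN mulr_ge0//.
    by rewrite oppr_ge0 ln_le0// ler_pdivrMr//; lra.
  by rewrite oppr_ge0 invr_le0 ltW.
have glam : gamma `^ lam = (1 - p) / p.
  rewrite /powR gt_eqF// /lam divfK ?lt_eqF//.
  by rewrite lnK// posrE.
have Vmono s t : 0 < s <= t -> V t <= V s.
  move=> /andP[s0 st]; have t0 := lt_le_trans s0 st.
  apply: ge0_ler_powR => //; rewrite ?nnegrE ?divr_ge0 ?(ltW a0) ?(ltW s0) ?(ltW t0)//.
  by rewrite ler_pM2l ?lef_pV2 ?posrE.
split => //.
- move=> s /andP[s0 sa]; suff : 1 `^ lam <= V s by rewrite powR1.
  apply: ge0_ler_powR => //; rewrite ?nnegrE ?divr_ge0 ?(ltW a0) ?(ltW s0)//.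
  by rewrite ler_pdivlMr// mul1r.
- move=> s s0.
  have as0 : 0 <= a / s by rewrite divr_ge0// ltW.
  split; rewrite /V.
    by rewrite invfM invrK mulrCA (powRM _ (ltW g0) as0) glam.
  have gV0 : 0 <= gamma^-1 by rewrite invr_ge0 ltW.
  rewrite invfM mulrCA (powRM _ gV0 as0).
  by rewrite -(powR_inv1 (ltW g0)) powRAC glam powR_inv1 ?invf_div// ltW.
Qed.

(** After logarithms, hypothesis and goal differ in [ln (2 * (1 - p))] against the smaller
    [ln ((1 - p) / p)]. Both multiply the nonpositive [ln (2 * beta)], so the replacement goes the
    right way. *)
Lemma gamma_powR_bound (R : realType) (gamma p beta omega : R) (n : nat) :
  0 < gamma < 1 -> 2^-1 < p < 1 -> 0 < beta <= 2^-1 -> 0 < omega -> (2 <= n)%N ->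
  (1 / (2 * (1 - p))) `^ (ln (2 * beta) / ((1 + omega) * ln n%:R)) <= gamma ->
  (2 * beta) `^ (ln ((1 - p) / p) / ln gamma) <= n%:R `^ (- (1 + omega)).
Proof.
move=> /andP[g0 g1] /andP[p2 p1] /andP[b0 b2] w0 n2 hg.
have p0 : 0 < p by lra.
have q0 : 0 < 1 - p by lra.
have nr : 1 < n%:R :> R by rewrite ltr1n.
have n0 : 0 < n%:R :> R by apply: lt_trans nr.
have lnn : 0 < ln (n%:R : R) by exact: ln_gt0.
have lng : ln gamma < 0 by rewrite ln_lt0// g0.
have tb0 : 0 < 2 * beta by rewrite mulr_gt0.
have tq0 : 0 < 2 * (1 - p) by rewrite mulr_gt0.
have lnb : ln (2 * beta) <= 0 by rewrite ln_le0//; lra.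
have lnq : ln (2 * (1 - p)) < 0 by rewrite ln_lt0// tq0; lra.
have lnr : ln ((1 - p) / p) <= ln (2 * (1 - p)).
  rewrite ler_ln ?posrE ?divr_gt0// ler_pdivrMr//; nra.
have hgl : - ln (2 * (1 - p)) * ln (2 * beta) <= ln gamma * ((1 + omega) * ln n%:R).
  move: hg; rewrite -ler_ln ?posrE//; last first.
    by rewrite powR_gt0// divr_gt0.
  rewrite ln_powR div1r lnV ?posrE// mulrAC ler_pdivrMr ?mulr_gt0//; last lra.
  by rewrite mulrC.
rewrite -ler_ln ?posrE ?powR_gt0// !ln_powR mulrAC ler_ndivrMr//.
have : (ln ((1 - p) / p) - ln (2 * (1 - p))) * ln (2 * beta) >= 0.
  by rewrite -mulrNN mulr_ge0// oppr_ge0// subr_le0.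
lra.
Qed.

Lemma low_hit_prob (R : realType) (d : measure_display) (T : measurableType d)
    (P : probability T R) (F : nat -> set_system T) (A : nat -> T -> R)
    (alive : nat -> set T) (gamma p abar beta omega : R) (n : nat) :
  drifting_walk P F A alive gamma p abar -> F 0%N setT ->
  (forall w, abar <= A 0%N w) ->
  0 < gamma < 1 -> 2^-1 < p < 1 -> 0 < abar ->
  0 < beta <= 2^-1 -> 0 < omega -> (2 <= n)%N ->
  (1 / (2 * (1 - p))) `^ (ln (2 * beta) / ((1 + omega) * ln n%:R)) <= gamma ->
  pr P (low_hit A alive (2 * beta * abar) 0 n)
    <= (1 - p)^-1 * n%:R `^ (- omega).
Proof.
move=> WF FT A0 hg hp abar0 hb w0 n2 hgam.
set a := 2 * beta * abar.
have p0 : 0 < p by lra.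
have q0 : 0 < 1 - p by lra.
have [g0 g1] := andP hg.
have a0 : 0 < a by rewrite mulr_gt0// mulr_gt0//; lra.
have [Vmono V1 Vstep] := drift_potential hg hp a0.
set V := (fun s => (a / s) `^ (ln ((1 - p) / p) / ln gamma)) in Vmono V1 Vstep.
have := @low_hit_bound _ _ _ P F A alive gamma p abar a WF V hg.
rewrite -(setTI (low_hit _ _ _ _ _)).
move=> /(_ _ abar0 (fun=> powR_ge0 _ _) Vmono V1 _ n 0%N abar setT FT abar0 (fun w _ => A0 w)).
move=> /(_ _ _)/le_trans; apply.
- lra.
- move=> s s0; rewrite /V (Vstep _ s0).1 (Vstep _ s0).2.
  move: ((a / s) `^ _) => v; rewrite [leLHS](_ : _ = v)//.
  by field; rewrite !gt_eqF.
have -> : pr P setT = 1 by rewrite /pr probability_setT.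
rewrite {2}/V (Vstep _ abar0).2 -/(V abar).
have nr : 1 <= n%:R :> R by rewrite ler1n ltnW.
have n0 : 0 < n%:R :> R by apply: lt_le_trans nr.
(* The ratio [a / abar] is [2 * beta]; one of the [1 + omega] powers of [n] is set apart to cancel
   the [n] steps. *)
have Va : V abar <= n%:R^-1 * n%:R `^ (- omega).
  rewrite /V /a mulfK ?gt_eqF//.
  apply: le_trans (gamma_powR_bound hg hp hb w0 n2 hgam) _.
  rewrite -(powR_inv1 (ltW n0)) -powRD; last by rewrite (gt_eqF n0) implybT.
  by rewrite opprD.
have Va0 : 0 <= V abar by exact: powR_ge0.
rewrite mulr1.
(* Bounding the single starting term by [n] copies lets [1 + p / (1 - p)] collapse to
   [1 / (1 - p)]. *)
apply: (@le_trans _ _ (n%:R * ((1 - p)^-1 * V abar))).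
  have e : (1 - p)^-1 = 1 + p / (1 - p) :> R by field; rewrite gt_eqF.
  rewrite [X in _ <= _ * (X * _)]e.
  have : V abar <= n%:R * V abar by rewrite ler_peMl.
  move: (p / _) (V abar) => c v h.
  by rewrite [leRHS](_ : _ = n%:R * v + n%:R * (c * v)) ?lerD2r//; ring.
rewrite mulrCA ler_pM2l ?invr_gt0//.
by rewrite -ler_pdivlMl.
Qed.

(** * Continuity of the gradient norm *)

Lemma continuous_sqrsum_sqrt (R : realType) (T : topologicalType) (m : nat)
    (f : 'I_m -> T -> R) :
  (forall i, continuous (f i)) ->
  continuous (fun x => Num.sqrt (\sum_(i < m) f i x ^+ 2)).
Proof.
move=> cf x; apply: (@continuous_comp _ _ _ (fun x => \sum_(i < m) f i x ^+ 2) Num.sqrt).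
  apply: cvg_big => [|i _]; first by move=> [u v]; exact: add_continuous.
  by rewrite expr2; under eq_fun do rewrite expr2; apply: cvgM; exact: cf.
exact: sqrt_continuous.
Qed.

Lemma coord_le_enorm (R : realType) (m : nat) (v : 'rV[R]_m) (i : 'I_m) :
  `|v 0 i| <= enorm v.
Proof.
rewrite -sqrtr_sqr ler_sqrt; last by apply: sumr_ge0 => j _; exact: sqr_ge0.
by rewrite (bigD1 i)//= lerDl sumr_ge0// => j _; exact: sqr_ge0.
Qed.

(** Each coordinate difference is squeezed by [|L| * enorm (x - y)], which is continuous in [y] and
    vanishes at [x]; the absolute value keeps the bound nonnegative whatever the sign of [L]. *)
Lemma grad_coord_continuous (R : realType) (m : nat) (L : R)
    (phi : 'rV[R]_m -> R) (i : 'I_m) :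
  smooth L phi -> continuous (fun x => grad phi x 0 i).
Proof.
move=> [_ lip] x; apply/(@cvgrPdist_lt _ _ _ (nbhs x) _) => e e0.
have cD : continuous (fun y : 'rV[R]_m => `|L| * enorm (x - y)).
  move=> y; apply: (@cvgMl_tmp _ _ (nbhs y)).
  apply: continuous_sqrsum_sqrt => j z.
  rewrite (_ : (fun u => _) = (fun u : 'rV[R]_m => x 0 j - u 0 j)); last first.
    by apply/funext => u; rewrite !mxE.
  apply: (@cvgB _ _ _ (nbhs z) _ (cst (x 0 j))); first exact: cvg_cst.
  exact: coord_continuous.
have := cD x => /(@cvgrPdist_lt _ _ _ (nbhs x) _) /(_ e e0).
apply: filterS => y; rewrite subrr.
have -> : enorm (0 : 'rV[R]_m) = 0.
  by rewrite /enorm big1 ?sqrtr0// => j _; rewrite mxE expr0n.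
rewrite mulr0 sub0r normrN => /le_lt_trans; apply.
have := coord_le_enorm (grad phi x - grad phi y) i.
rewrite [X in `|X|]mxE [X in `|_ + X|]mxE => /le_trans; apply.
apply: (le_trans (lip x y)); rewrite ger0_norm; last by rewrite mulr_ge0// sqrtr_ge0.
by rewrite ler_wpM2r ?sqrtr_ge0// ler_norm.
Qed.

Lemma open_enorm_grad_gt (R : realType) (m : nat) (L eps : R)
    (phi : 'rV[R]_m -> R) :
  smooth L phi -> open [set x | eps < enorm (grad phi x)].
Proof.
move=> sm; have cG : continuous (fun x => enorm (grad phi x)).
  by apply: continuous_sqrsum_sqrt => i; exact: grad_coord_continuous sm.
rewrite [X in open X](_ : _ = (fun x => enorm (grad phi x)) @^-1` [set t | eps < t])//.
by apply: open_comp => //; exact: open_gt.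
Qed.

Lemma borel_measurable_fun (R : realType) (d : measure_display)
    (T : measurableType d) (f : T -> R) : borel_fun f -> measurable_fun setT f.
Proof.
move=> bf; apply: (measurability (@RGenOInfty.G R)).
  exact: RGenOInfty.measurableE.
move=> _ [_ [x ->] <-]; rewrite setTI; apply: bf.
by rewrite set_itv_o_infty; exact: open_gt.
Qed.

(** * The stopping time and the filtration *)

Section storm_theory.
Context (R : realType) (dO dX : measure_display) (Omega : measurableType dO).
Context (Xi : measurableType dX) (m : nat) (St : storm_run R Omega Xi m).
Context (phi : 'rV[R]_m -> R) (eps : R).

(** The event that the stopping time exceeds [k], spelled out through finitely many iterates so that
    it visibly belongs to [filtration St k]. *)
Definition not_stopped (k : nat) : set Omega :=
  [set w | forall l, (l <= k)%N -> eps < enorm (grad phi (rx St l w))].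

Lemma le_stop_timeP (c : R) (w : Omega) :
  (c%:E <= stop_time phi eps St w)%E <->
  (forall k, k%:R < c -> eps < enorm (grad phi (rx St k w))).
Proof.
split.
  move=> /ereal_infP h k kc; rewrite ltNge; apply/negP => Gk.
  have := h (k%:R)%:E; rewrite lee_fin leNgt kc => /(_ _)/negP; apply => //.
  by exists k.
move=> h; apply/ereal_infP => _ [k /= Gk <-]; rewrite lee_fin leNgt.
by apply/negP => /h; rewrite ltNge Gk.
Qed.

Lemma lt_stop_timeP (k : nat) (w : Omega) :
  ((k%:R)%:E < stop_time phi eps St w)%E <-> not_stopped k w.
Proof.
split=> [kT l lk|h].
  rewrite ltNge; apply/negP => Gl; move: kT; apply/negP; rewrite -leNgt.
  apply: (@le_trans _ _ (l%:R)%:E); last by rewrite lee_fin ler_nat.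
  by apply: ereal_inf_lbound; exists l.
(* The stopping time is integral or infinite: exceeding [k] means being at least [k + 1]. *)
apply: (@lt_le_trans _ _ (k.+1%:R)%:E); first by rewrite lte_fin ltr_nat.
by apply/le_stop_timeP => l; rewrite ltr_nat ltnS; exact: h.
Qed.

Lemma le_stop_time_natP (k : nat) (w : Omega) :
  ((k%:R)%:E <= stop_time phi eps St w)%E <->
  (forall l, (l < k)%N -> not_stopped l w).
Proof.
split=> [/le_stop_timeP h l lk j jl|h]; first by apply: h; rewrite ltr_nat (leq_ltn_trans jl).
by apply/le_stop_timeP => l; rewrite ltr_nat => lk; exact: h lk _ (leqnn l).
Qed.

Lemma stop_time_measurable :
  (forall k, measurable [set w | eps < enorm (grad phi (rx St k w))]) ->
  measurable_fun setT (stop_time phi eps St).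
Proof.
move=> mG; apply: (measurability (@ErealGenCInfty.G R)).
  exact: ErealGenCInfty.measurableE.
move=> _ [_ [c ->] <-]; rewrite setTI.
rewrite [X in measurable X](_ : _ = \bigcap_(k in [set k : nat | k%:R < c])
    [set w | eps < enorm (grad phi (rx St k w))]).
  exact: bigcap_measurableType.
apply/seteqP; split => w /=.
  by rewrite in_itv/= andbT => /le_stop_timeP h k; exact: h.
by move=> h; rewrite in_itv/= andbT; apply/le_stop_timeP => k; exact: h.
Qed.

Lemma sigma_algebra_generatedI (G : set (set Omega)) (A B : set Omega) :
  <<s G >> A -> <<s G >> B -> <<s G >> (A `&` B).
Proof.
move=> GA GB; exact: (@measurableI _ (g_sigma_algebraType G)).
Qed.

Lemma filtration_rx (k l : nat) (U : set 'rV[R]_m) :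
  (l <= k)%N -> open U -> filtration St k (rx St l @^-1` U).
Proof.
move=> lk oU; apply: sub_sigma_algebra; left; exists l => //; left.
by exists U => //; rewrite setTI.
Qed.

Lemma filtration_ralpha (k : nat) (U : set R) :
  open U -> filtration St k (ralpha St k @^-1` U).
Proof.
move=> oU; apply: sub_sigma_algebra; left; exists k => //=; right.
by exists U => //; rewrite setTI.
Qed.

Lemma filtration_mono (k : nat) : filtration St k `<=` filtration St k.+1.
Proof.
apply: smallest_sub; first exact: smallest_sigma_algebra.
move=> A [[j /= jk Aj]|[j /= jk Aj]]; apply: sub_sigma_algebra.
  by left; exists j => //=; exact: leq_trans jk _.
by right; exists j => //=; exact: leq_trans jk _.
Qed.

Lemma filtration_not_stopped (L : R) (k : nat) :
  smooth L phi -> filtration St k (not_stopped k).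
Proof.
move=> sm.
rewrite (_ : not_stopped k = \bigcap_(l in [set l | (l <= k)%N])
   (rx St l @^-1` [set x | eps < enorm (grad phi x)])); last first.
  by apply/seteqP; split => w h l; exact: h.
apply: (@bigcap_measurableType _ (g_sigma_algebraType (past_events St k))).
by move=> l lk; apply: filtration_rx => //; exact: open_enorm_grad_gt sm.
Qed.

End storm_theory.

(** * The trust-region radius as a drifting walk *)

Section storm_cost.
Context (R : realType) (dO dX : measure_display) (Omega : measurableType dO).
Context (Xi : measurableType dX) (m : nat) (St : storm_run R Omega Xi m).
Context (phi : 'rV[R]_m -> R).

Lemma filtration_measurable (k : nat) :
  (forall j, borel_fun (rx St j) /\ borel_fun (ralpha St j) /\
    borel_fun (rg St j) /\ borel_fun (rH St j) /\ borel_fun (rs St j) /\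
    borel_fun (rf0 St j) /\ borel_fun (rfp St j)) ->
  (forall j i, [/\ measurable_fun setT (data_g St j i),
    measurable_fun setT (data_f0 St j i) & measurable_fun setT (data_fp St j i)]) ->
  filtration St k `<=` measurable.
Proof.
move=> bor dat; apply: smallest_sub; first exact: sigma_algebra_measurable.
have openm (T : topologicalType) (f : Omega -> T) :
    borel_fun f -> open_events f `<=` measurable.
  by move=> bf _ [U oU <-]; rewrite setTI; exact: bf.
have datam (Y : nat -> Omega -> Xi) : (forall i, measurable_fun setT (Y i)) ->
    data_events Y `<=` measurable.
  by move=> mY _ [i _ [U mU <-]]; exact: mY.
move=> A [[j _ []]|[j _ []]]; have [bx [ba [bg [bH [bs [bf0 bfp]]]]]] := bor j.
- exact: openm.
- exact: openm.
- move=> [[[]|]|]; try exact: openm.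
  by apply: datam => i; have [] := dat j i.
- move=> [[[]|]|]; try exact: openm.
  + by apply: datam => i; have [] := dat j i.
  + by apply: datam => i; have [] := dat j i.
Qed.

Lemma ralpha_bounds (gamma theta theta2 alphamax alpha0 : R) (x0 : 'rV[R]_m) :
  storm_algorithm phi gamma theta theta2 alphamax alpha0 x0 St ->
  0 < gamma < 1 -> 0 < alpha0 <= alphamax ->
  forall k w, 0 < ralpha St k w <= alphamax.
Proof.
move=> alg /andP[g0 g1] /andP[a0 amax] k w; elim: k => [|k /andP[IH0 IH1]].
  by have [_ ->] := storm_init alg w; rewrite a0.
rewrite (storm_next_alpha alg); case: ifP => _.
  by rewrite lt_min ge_min lexx orbT andbT mulr_gt0 ?invr_gt0//= (lt_le_trans a0).
by rewrite mulr_gt0//= (le_trans _ IH1)// ler_piMl// ltW.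
Qed.

(** On a successful step the cap cannot undercut the factor [gamma], since the current radius is
    itself at most [alphamax]. *)
Lemma ralpha_down (gamma theta theta2 alphamax alpha0 : R) (x0 : 'rV[R]_m) :
  storm_algorithm phi gamma theta theta2 alphamax alpha0 x0 St ->
  0 < gamma < 1 -> 0 < alpha0 <= alphamax ->
  forall k w, gamma * ralpha St k w <= ralpha St k.+1 w.
Proof.
move=> alg hg ha k w; have /andP[r0 rmax] := ralpha_bounds alg hg ha k w.
have /andP[g0 g1] := hg.
rewrite (storm_next_alpha alg); case: ifP => // _.
rewrite le_min ler_pM2r// (le_trans (ltW g1)) ?invf_ge1 ?(ltW g1)//=.
by rewrite (le_trans _ rmax)// ler_piMl// ltW.
Qed.

Lemma storm_drifting_walk (P : probability Omega R) (D : probability Xi R)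
    (l : 'rV[R]_m -> Xi -> R) (L sigf sigg delta0 delta1 kef keg : R)
    (gamma theta theta2 alphamax alpha0 eps zeta p : R) (x0 : 'rV[R]_m) :
  smooth L phi -> 0 < gamma < 1 -> 0 < alpha0 <= alphamax ->
  storm_algorithm phi gamma theta theta2 alphamax alpha0 x0 St ->
  storm_oracles P D l sigf sigg delta0 delta1 kef keg St ->
  storm_increase_property P phi eps zeta gamma p St ->
  drifting_walk P (filtration St) (ralpha St) (not_stopped St phi eps) gamma p
    (eps / zeta).
Proof.
move=> sm hg ha alg orc inc.
have bor := storm_borel alg.
have ma k : measurable_fun setT (ralpha St k).
  by apply: borel_measurable_fun; have [_ []] := bor k.
split.
- by move=> k B C; exact: sigma_algebra_generatedI.
- by move=> k B; exact: sigma_algebraC.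
- exact: filtration_mono.
- move=> k; apply: filtration_measurable => // j i; split.
  + by have [] := iid_g orc j.
  + by have [] := iid_f0 orc j.
  + by have [] := iid_fp orc j.
- move=> k c; split.
    rewrite (_ : [set w | _] = ~` (ralpha St k @^-1` [set t | c < t])).
      by apply: sigma_algebraC; apply: filtration_ralpha; exact: open_gt.
    by apply/seteqP; split => w /=; rewrite leNgt => /negP.
  rewrite (_ : [set w | _] = ~` (ralpha St k @^-1` [set t | t < c])).
    by apply: sigma_algebraC; apply: filtration_ralpha; exact: open_lt.
  by apply/seteqP; split => w /=; rewrite leNgt => /negP.
- by move=> k; exact: filtration_not_stopped sm.
- move=> k.
  rewrite (_ : [set w | _] = setT `&`
      (fun w => ralpha St k.+1 w == gamma^-1 * ralpha St k w) @^-1` [set true]).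
    apply: measurable_fun_eqr => //.
    by apply: measurable_funM => //; exact: measurable_cst.
  by rewrite setTI; apply/seteqP; split => w /= /eqP.
- exact: ralpha_down alg hg ha.
- move=> k; rewrite (_ : [set w | not_stopped _ _ _ _ _ /\ _] =
    [set w | ((k%:R)%:E < stop_time phi eps St w)%E /\ ralpha St k w <= eps / zeta]).
    exact: inc.
  by apply/seteqP; split => w [/lt_stop_timeP ? ?].
Qed.

(** * The sample cost *)

Lemma oc0_ge0 (sigf delta0 kef alpha : R) : 0 <= delta0 ->
  0 <= oc0 sigf delta0 kef alpha.
Proof.
move=> d0; rewrite /oc0 divr_ge0 ?sqr_ge0// mulr_ge0 ?exprn_even_ge0//.
by rewrite mulr_ge0 ?sqr_ge0.
Qed.

Lemma oc1_ge0 (sigg delta1 keg alpha : R) : 0 <= delta1 ->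
  0 <= oc1 sigg delta1 keg alpha.
Proof.
move=> d0; rewrite /oc1 divr_ge0 ?sqr_ge0// mulr_ge0 ?sqr_ge0//.
by rewrite mulr_ge0 ?sqr_ge0.
Qed.

Lemma measurable_fun_divX (f : Omega -> R) (c e : R) (n : nat) :
  0 <= e -> (forall w, 0 <= f w) -> measurable_fun setT f ->
  measurable_fun setT (fun w => c / (e * f w ^+ n)).
Proof.
move=> e0 f0 mf.
(* The real power of exponent [-1] is measurable and agrees with the inverse on nonnegative
   reals. *)
rewrite (_ : (fun w => _) = (fun w => c * ((fun x : R => x `^ (-1)) \o (fun w => e * f w ^+ n)) w)).
  apply: measurable_funM; first exact: measurable_cst.
  apply: measurableT_comp; first exact: measurable_powR.
  apply: measurable_funM; first exact: measurable_cst.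
  exact: measurable_funX.
by apply/funext => w /=; rewrite powR_inv1// mulr_ge0// exprn_ge0.
Qed.

Lemma TOC_measurable (eps sigf sigg delta0 delta1 kef keg : R) :
  0 <= delta0 -> 0 <= delta1 -> (forall k w, 0 <= ralpha St k w) ->
  (forall k, measurable_fun setT (ralpha St k)) ->
  measurable_fun setT (stop_time phi eps St) ->
  measurable_fun setT (TOC phi eps sigf sigg delta0 delta1 kef keg St).
Proof.
move=> d0 d1 a0 ma mT.
pose c k w := (oc0 sigf delta0 kef (ralpha St k w) +
               oc1 sigg delta1 keg (ralpha St k w))%:E.
apply: (@emeasurable_fun_cvg _ _ _ _ (fun N w =>
  (\sum_(1 <= k < N | ((k%:R)%:E <= stop_time phi eps St w)%E) c k w)%E)).
  move=> N.
  (* The index set depends on [w]; moving its condition into the terms leaves a sum over a fixed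
     range. *)
  rewrite (_ : (fun w => _) = (fun w => (\sum_(1 <= k < N)
      (if ((k%:R)%:E <= stop_time phi eps St w)%E then c k w else 0%E))%E)).
    apply: emeasurable_sum => k; apply: measurable_fun_ifT => //.
      apply: (@measurable_fun_bool _ _ _ _ true).
      rewrite (_ : _ @^-1` _ = [set w | ((k%:R)%:E <= stop_time phi eps St w)%E]).
        exact: emeasurable_fun_c_infty.
      by apply/seteqP; split.
    apply/measurable_EFinP; apply: measurable_funD.
      by apply: measurable_fun_divX => //; rewrite mulr_ge0// sqr_ge0.
    by apply: measurable_fun_divX => //; rewrite mulr_ge0// sqr_ge0.
  by apply/funext => w; rewrite big_mkcond.
move=> w _; apply: is_cvg_nneseries => k _ _.
by rewrite lee_fin addr_ge0 ?oc0_ge0 ?oc1_ge0.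
Qed.

Lemma sum_indices_le (x c : R) (Q : pred nat) (N : nat) : 0 <= x -> 0 <= c ->
  (forall k, Q k -> k%:R <= x) -> \sum_(1 <= k < N | Q k) c <= c * x.
Proof.
move=> x0 c0 Qx; case: N => [|N]; first by rewrite big_geq// mulr_ge0.
(* The second bound carries the induction: when a new index is counted, the terms so far number at
   most that index, which is at most [x]. *)
suff /andP[] : (\sum_(1 <= k < N.+1 | Q k) c <= c * x) &&
    (\sum_(1 <= k < N.+1 | Q k) c <= c * N%:R) by [].
elim: N => [|N /andP[IH1 IH2]]; first by rewrite big_geq// mulr0 lexx mulr_ge0.
rewrite big_mkcond big_nat_recr//= -big_mkcond/= -natr1 mulrDr mulr1.
case: ifPn => [/Qx QN|_]; last by rewrite addr0 IH1 (le_trans IH2)// lerDl.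
rewrite lerD2r IH2 andbT; apply: (@le_trans _ _ (c * N.+1%:R)).
  by rewrite -natr1 mulrDr mulr1 lerD2r.
by rewrite ler_wpM2l.
Qed.

(** Costs decrease in the radius, so each of the at most [x] paid iterations costs no more than one
    at radius [a]. *)
Lemma TOC_le (eps sigf sigg delta0 delta1 kef keg a x : R) (w : Omega) :
  0 < delta0 -> 0 < delta1 -> 0 < kef -> 0 < keg -> 0 < a -> 0 <= x ->
  (stop_time phi eps St w <= x%:E)%E ->
  (forall k, ((k%:R)%:E <= stop_time phi eps St w)%E -> a <= ralpha St k w) ->
  (TOC phi eps sigf sigg delta0 delta1 kef keg St w <=
    ((oc0 sigf delta0 kef a + oc1 sigg delta1 keg a) * x)%:E)%E.
Proof.
move=> d0 d1 kf kg a0 x0 Tx low.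
have c0 b : 0 <= oc0 sigf delta0 kef b + oc1 sigg delta1 keg b.
  by rewrite addr_ge0 ?oc0_ge0 ?oc1_ge0// ltW.
apply: lime_le.
  by apply: is_cvg_nneseries => k _ _; rewrite lee_fin.
near=> N.
rewrite sumEFin lee_fin.
apply: (@le_trans _ _ (\sum_(1 <= k < N | ((k%:R)%:E <= stop_time phi eps St w)%E)
    (oc0 sigf delta0 kef a + oc1 sigg delta1 keg a))); last first.
  by apply: sum_indices_le => // k kT; rewrite -lee_fin (le_trans kT).
apply: ler_sum => k /low ak.
have r0 : 0 < ralpha St k w by exact: lt_le_trans ak.
have aX n : a ^+ n <= ralpha St k w ^+ n.
  by rewrite lerXn2r ?nnegrE ?(ltW a0) ?(ltW r0).
apply: lerD.
  rewrite /oc0 ler_wpM2l ?sqr_ge0// lef_pV2 ?posrE ?mulr_gt0 ?exprn_gt0//.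
  by rewrite ler_pM2l ?mulr_gt0 ?exprn_gt0.
rewrite /oc1 ler_wpM2l ?sqr_ge0// lef_pV2 ?posrE ?mulr_gt0 ?exprn_gt0//.
by rewrite ler_pM2l ?mulr_gt0 ?exprn_gt0.
Unshelve. all: by end_near. Qed.

End storm_cost.

(** * Markov's inequality and the complexity bound *)

Lemma stop_time_ge0 (R : realType) (dO dX : measure_display)
    (Omega : measurableType dO) (Xi : measurableType dX) (m : nat)
    (St : storm_run R Omega Xi m) (phi : 'rV[R]_m -> R) (eps : R) (w : Omega) :
  (0 <= stop_time phi eps St w)%E.
Proof. by apply: le_ereal_inf_tmp => _ [k _ <-]; rewrite lee_fin. Qed.

Lemma markov_ereal (R : realType) (d : measure_display) (T : measurableType d)
    (P : probability T R) (X : T -> \bar R) (c C : R) :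
  0 < c -> 0 < C -> (forall w, (0 <= X w)%E) -> measurable_fun setT X ->
  (\int[P]_w X w <= c%:E)%E ->
  pr P [set w | ((C * c)%:E <= X w)%E] <= 1 / C.
Proof.
move=> c0 C0 X0 mX IX.
have Cc0 : 0 < C * c by rewrite mulr_gt0.
have mA : measurable [set w | ((C * c)%:E <= X w)%E].
  by rewrite -[X in measurable X]setTI; exact: emeasurable_fun_c_infty.
have := le_integral_abse P measurableT mX Cc0; rewrite setTI.
have -> : (fun x => `|X x|%E) = X by apply/funext => x; rewrite gee0_abs.
rewrite (_ : [set x | _ <= `|X x|]%E = [set w | ((C * c)%:E <= X w)%E]); last first.
  by apply/seteqP; split => w /=; rewrite gee0_abs.
move=> /le_trans/(_ IX) h.
have : ((C * c)%:E * (pr P [set w | ((C * c)%:E <= X w)%E])%:E <= c%:E)%E by rewrite prE.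
rewrite -EFinM lee_fin.
by rewrite -mulrA mulrCA ger_pMr// mulrC -ler_pdivlMr.
Qed.

Theorem theorem5 (R : realType) (delta0 delta1 kef keg zeta beta C1 C2 : R)
    (hdelta0 : 0 < delta0) (hdelta1 : 0 < delta1)
    (hkef : 0 < kef) (hkeg : 0 < keg) (hzeta : 0 < zeta)
    (hbeta : 0 < beta <= 2^-1) (hC1 : 0 < C1) (hC2 : 1 < C2) :
  let p := 1 - delta0 - delta1 in
  let q := 1 - p in
  2^-1 < p -> 0 < q ->
  exists K1 K2 : R, 0 < K1 /\ 0 < K2 /\
  forall (dX : measure_display) (Xi : measurableType dX) (D : probability Xi R)
    (m : nat) (l : 'rV[R]_m -> Xi -> R) (L sigf sigg : R),
  erm_setting D l L sigf sigg ->
  let phi := risk D l in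
  forall (gamma theta theta2 alphamax alpha0 eps omega : R) (x0 : 'rV[R]_m)
    (n : nat),
  0 < gamma < 1 -> 0 < theta < 1 -> 0 < theta2 -> alpha0 <= alphamax ->
  0 < eps -> eps / zeta <= alpha0 ->
  forall (dO : measure_display) (Omega : measurableType dO)
    (P : probability Omega R) (St : storm_run R Omega Xi m),
  storm_algorithm phi gamma theta theta2 alphamax alpha0 x0 St ->
  storm_oracles P D l sigf sigg delta0 delta1 kef keg St ->
  storm_increase_property P phi eps zeta gamma p St ->
  (\int[P]_w stop_time phi eps St w <= (C1 / eps ^+ 2)%:E)%E ->
  (2 <= n)%N -> C2 * (C1 / eps ^+ 2) <= n%:R ->
  0 < omega ->
  Num.max 2^-1
    ((1 / (2 * q)) `^ (ln (2 * beta) / ((1 + omega) * ln n%:R))) <= gamma ->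
  ((1 - 1 / C2 - K1 * n%:R `^ (- omega))%:E <=
   P [set w | (TOC phi eps sigf sigg delta0 delta1 kef keg St w <=
               (K2 * (sigf ^+ 2 / eps ^+ 6 + sigg ^+ 2 / eps ^+ 4))%:E)%E])%E.
Proof.
move=> p q p2 q0.
have p1 : p < 1 by rewrite /p; lra.
have [b0 b2] := andP hbeta.
have C20 : 0 < C2 by exact: lt_trans hC2.
(* [M] and [M'] are the costs at radius [2 * beta * (eps / zeta)], stripped of the variance bounds
   and of [eps]. *)
pose M := zeta ^+ 4 / (delta0 * kef ^+ 2 * (2 * beta) ^+ 4).
pose M' := zeta ^+ 2 / (delta1 * keg ^+ 2 * (2 * beta) ^+ 2).
have M0 : 0 < M by rewrite divr_gt0 ?mulr_gt0 ?exprn_gt0 ?mulr_gt0.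
have M1 : 0 < M' by rewrite divr_gt0 ?mulr_gt0 ?exprn_gt0 ?mulr_gt0.
(* [q^-1] comes from [low_hit_prob], and [C2 * C1] from the cap [C2 * (C1 / eps ^+ 2)] on the number
   of iterations, which also raises the powers 4 and 2 of [eps] to 6 and 4. *)
exists q^-1, (C2 * C1 * (M + M')).
split; first by rewrite invr_gt0.
split; first by rewrite !mulr_gt0// addr_gt0.
move=> dX Xi D m l L sigf sigg erm phi gamma theta theta2 alphamax alpha0 eps
  omega x0 n hg htheta htheta2 amax eps0 epsa dO Omega P St alg orc inc ET n2 nC w0 hgam.
have sm : smooth L phi := erm_smooth erm.
have abar0 : 0 < eps / zeta by exact: divr_gt0.
have ha : 0 < alpha0 <= alphamax by rewrite (lt_le_trans abar0).
have walk := storm_drifting_walk sm hg ha alg orc inc.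
have hgam' : (1 / (2 * (1 - p))) `^ (ln (2 * beta) / ((1 + omega) * ln n%:R)) <= gamma.
  by move: hgam; rewrite ge_max => /andP[].
set a := 2 * beta * (eps / zeta).
have a0 : 0 < a by rewrite !mulr_gt0 ?invr_gt0.
have hp : 2^-1 < p < 1 by rewrite p2.
have FT : filtration St 0 setT.
  rewrite -setC0; apply: sigma_algebraC; exact: sigma_algebra0.
have hitP : pr P (low_hit (ralpha St) (not_stopped St phi eps) a 0 n)
    <= q^-1 * n%:R `^ (- omega).
  apply: low_hit_prob walk FT _ hg hp abar0 hbeta w0 n2 hgam'.
  by move=> w; have [_ ->] := storm_init alg w.
set Hit := low_hit _ _ _ _ _ in hitP.
have mHit : measurable Hit by exact: low_hit_measurable walk _ _.
have mG k : measurable [set w | eps < enorm (grad phi (rx St k w))].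
  have [bx _] := storm_borel alg k.
  exact: bx (open_enorm_grad_gt (eps := eps) sm).
have mT := stop_time_measurable mG.
have ma k : measurable_fun setT (ralpha St k).
  by apply: borel_measurable_fun; have [_ []] := storm_borel alg k.
set x := C2 * (C1 / eps ^+ 2).
have e20 : 0 < C1 / eps ^+ 2 by rewrite divr_gt0 ?exprn_gt0.
have x0' : 0 < x by rewrite mulr_gt0.
have lateP := markov_ereal e20 C20 (stop_time_ge0 St phi eps) mT ET.
set Late := [set w | _] in lateP.
have mLate : measurable Late.
  by rewrite -[X in measurable X]setTI; exact: emeasurable_fun_c_infty.
set Good := [set w | _].
have mGood : measurable Good.
  rewrite -[X in measurable X]setTI; apply: emeasurable_fun_infty_c => //.
  apply: TOC_measurable => //; try exact: ltW.
  by move=> k w; have /andP[/ltW] := ralpha_bounds alg hg ha k w.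
have mBad : measurable (Late `|` Hit) by exact: measurableU.
have goodP : ~` (Late `|` Hit) `<=` Good.
  move=> w /not_orP[/negP nL nH].
  have Tx : (stop_time phi eps St w < x%:E)%E by rewrite ltNge.
  have low k : ((k%:R)%:E <= stop_time phi eps St w)%E -> a <= ralpha St k w.
    move=> kT; rewrite leNgt; apply/negP => /ltW ka; apply: nH.
    (* A paid iteration [k] is at most [n], hence within the horizon. It may be the stopping time
       itself, which is why only the earlier iterations have to be alive. *)
    apply: (@low_hit_at _ _ _ _ _ _ _ _ k) => //.
      by rewrite -(ler_nat R) (le_trans _ nC)// -lee_fin (le_trans kT)// ltW.
    by have /le_stop_time_natP := kT.
  apply: (le_trans (TOC_le _ _ _ _ _ _ _ _ (ltW Tx) low)) => //; first exact: ltW.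
  rewrite lee_fin.
  have -> : oc0 sigf delta0 kef a = M * (sigf ^+ 2 / eps ^+ 4).
    by rewrite /oc0 /M /a; field; rewrite !gt_eqF.
  have -> : oc1 sigg delta1 keg a = M' * (sigg ^+ 2 / eps ^+ 2).
    by rewrite /oc1 /M' /a; field; rewrite !gt_eqF.
  have -> : (M * (sigf ^+ 2 / eps ^+ 4) + M' * (sigg ^+ 2 / eps ^+ 2)) * x =
      C2 * C1 * (M * (sigf ^+ 2 / eps ^+ 6) + M' * (sigg ^+ 2 / eps ^+ 4)).
    by rewrite /x; field; rewrite gt_eqF.
  rewrite -[leRHS]mulrA ler_pM2l ?mulr_gt0//.
  have s1 : 0 <= sigf ^+ 2 / eps ^+ 6 by rewrite divr_ge0 ?sqr_ge0 ?exprn_ge0 ?ltW.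
  have s2 : 0 <= sigg ^+ 2 / eps ^+ 4 by rewrite divr_ge0 ?sqr_ge0 ?exprn_ge0 ?ltW.
  (* Enlarging both [M] and [M'] to [M + M'] adds exactly these two nonnegative cross terms. *)
  have := mulr_ge0 (ltW M0) s2; have := mulr_ge0 (ltW M1) s1; lra.
apply: (@le_trans _ _ (P (~` (Late `|` Hit)))); last first.
  by apply: le_measure => //; rewrite inE//; exact: measurableC.
rewrite probability_setC// -(prE P mBad) -EFinB lee_fin.
have : pr P (Late `|` Hit) <= pr P Late + pr P Hit.
  by rewrite -lee_fin EFinD !prE//; exact: measureU2.
by move: lateP hitP; lra.
Qed.
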